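(* For each positive integer $N$ there exist a compact metric space $X$ and a homeomorphism of $X$ that is cw$(2^N)$-hyperbolic and is not cw$(2^N-1)$-expansive.
   Context: Let $f$ be a homeomorphism of a compact metric space $(X,d)$. For $c>0$ and $x\in X$ put $W^s_c(x)=\{y\in X: d(f^n(x),f^n(y))\le c \text{ for all } n\ge 0\}$ and $W^u_c(x)=\{y\in X: d(f^{-n}(x),f^{-n}(y))\le c \text{ for all } n\ge 0\}$. Let $C^s_c(x)$ (resp. $C^u_c(x)$) be the connected component of $W^s_c(x)$ (resp. $W^u_c(x)$) containing $x$. $f$ is cw-expansive if there is $c>0$ such that $W^u_c(x)\cap W^s_c(x)$ is totally disconnected for every $x\in X$. $f$ satisfies the cw-local-product-structure if for each $\varepsilon>0$ there is $\delta>0$ such that $C^s_\varepsilon(x)\cap C^u_\varepsilon(y)\ne\emptyset$ whenever $d(x,y)<\delta$. $f$ is cw-hyperbolic if it is cw-expansive and satisfies the cw-local-product-structure; by convention, saying that $f$ is cw-hyperbolic includes that $X$ is a Peano continuum (compact, connected, locally connected metric space). For a positive integer $M$, a cw-expansive homeomorphism $f$ is cw$M$-expansive, also written cw$(M)$-expansive, if there is $c>0$ such that $\#(C^s_c(x)\cap C^u_c(x))\le M$ for every $x\in X$; $f$ is cw$M$-hyperbolic, also written cw$(M)$-hyperbolic, if it is cw-hyperbolic and cw$M$-expansive. *)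

(* Defs.v *)
From HB Require Import structures.
From mathcomp Require Import all_boot all_order all_algebra.
From mathcomp Require Import all_classical all_reals all_analysis.

Set Implicit Arguments.
Unset Strict Implicit.
Unset Printing Implicit Defensive.

Import Order.TTheory GRing.Theory Num.Theory.

Local Open Scope classical_set_scope.
Local Open Scope card_scope.
Local Open Scope ring_scope.

Record homeo (X : topologicalType) := Homeo {
  homeo_fun :> X -> X;
  homeo_inv : X -> X;
  homeo_funK : cancel homeo_fun homeo_inv;
  homeo_invK : cancel homeo_inv homeo_fun;
  homeo_continuous : continuous homeo_fun;
  homeo_inv_continuous : continuous homeo_inv
}.

Definition locally_connected (X : topologicalType) : Prop :=
  forall (x : X) (U : set X), nbhs x U ->
    exists V : set X, [/\ open V, V x, connected V & V `<=` U].

Definition peano_continuum (R : realType) (X : metricType R) : Prop :=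
  [/\ compact [set: X], connected [set: X] & locally_connected X].

Section CwDynamics.
Context {R : realType} {X : metricType R} (f : homeo X).

Definition Ws (c : R) (x : X) : set X :=
  [set y | forall n : nat, mdist (iter n f x) (iter n f y) <= c].

Definition Wu (c : R) (x : X) : set X :=
  [set y | forall n : nat,
    mdist (iter n (homeo_inv f) x) (iter n (homeo_inv f) y) <= c].

Definition Cs (c : R) (x : X) : set X := connected_component (Ws c x) x.

Definition Cu (c : R) (x : X) : set X := connected_component (Wu c x) x.

Definition cw_expansive : Prop :=
  exists2 c : R, 0 < c &
    forall x : X, totally_disconnected (Wu c x `&` Ws c x).

Definition cw_local_product_structure : Prop :=
  forall eps : R, 0 < eps ->
    exists2 delta : R, 0 < delta &
      forall x y : X, mdist x y < delta -> Cs eps x `&` Cu eps y !=set0.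

Definition cw_hyperbolic : Prop :=
  [/\ peano_continuum X, cw_expansive & cw_local_product_structure].

Definition cwM_expansive (M : nat) : Prop :=
  cw_expansive /\
  exists2 c : R, 0 < c & forall x : X, Cs c x `&` Cu c x #<= `I_M.

Definition cwM_hyperbolic (M : nat) : Prop :=
  cw_hyperbolic /\ cwM_expansive M.

End CwDynamics.

(* Main.v *)
Require Import Defs.
From HB Require Import structures.
From mathcomp Require Import all_boot all_order all_algebra.
From mathcomp Require Import all_classical all_reals all_analysis.
From mathcomp Require Import ring lra zify.

(** The example for [N = 1] is a linear pseudo-Anosov map of the sphere, and the
general one is the product of [N] copies of it.

The sphere is the pillowcase: the quotient [ppi] of the plane by the group of the
maps [p |-> v + p] and [p |-> v - p], with [v] in a lattice. In the
eigencoordinates of the map, the lattice is the ring of integers of the golden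
field, embedded in the plane by [a + b phi |-> (a + b phi, a + b psi)] with
[phi psi = -1], and the map is [F : (u, s) |-> (phi u, psi s)]. Its inverse on the
quotient is [(u, s) |-> (psi u, phi s)], because [phi psi = -1] and [-1] belongs
to the group. A nonzero lattice vector has maximum norm at least [1], the
product of its coordinates being a nonzero integer (the field norm).

The heart of the proof is that, for small [c], every point of the continuum
[C^s_c(ppi p)] lifts to the vertical line through [p] ([component_sub_leaf]).
The whole set [W^s_c] does not satisfy this: an orbit which passes near a cone
point lets a companion orbit move from one lift to the other. But a connected
set can be explored by arbitrarily small steps. Take steps so small that their
first [n] images are still small. Then, at each time [m <= n], the lifts of
consecutive points are near points of the group orbit of [F^m p] which are near
each other, and since at most two points of a group orbit fit in a small ball, all of these stay
within a fixed distance of [F^m p]. So the horizontal displacement from [p],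
which is multiplied by [phi] at each iteration, is of order [phi^-n]. As [n]
grows only two lifts compete, so that one of them has displacement [0].

Conversely short vertical segments shrink, hence project into [C^s_c].
Therefore a point common to [C^s_c(ppi p)] and [C^u_c(ppi p)] has a lift on the
vertical and a lift on the horizontal line through [p]. If the two lifts differ
by a translation the point is [ppi p]; if they differ by a half turn, this half turn
is unique. So there are at most two points ([pillow_meet_le2]). Both occur if
[p = (t, t)], since [(t, -t)] and [(-t, t)] are exchanged by a half turn
([pillow_meet_ge2]). Finiteness of these intersections gives cw-expansivity
([cw_expansive_of_finite]), and everything is compatible with products, where
the cardinalities multiply ([cw_sharp_prod]). *)

Set Implicit Arguments.
Unset Strict Implicit.
Unset Printing Implicit Defensive.

Import Order.TTheory GRing.Theory Num.Theory.
Import numFieldNormedType.Exports.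

Local Open Scope classical_set_scope.
Local Open Scope card_scope.
Local Open Scope ring_scope.

(** * Connected subsets of metric spaces *)

Section MetricConnectedness.
Context {R : realType} {X : metricType R}.

Lemma nbhs_mdist (x : X) (A : set X) :
  nbhs x A <-> exists2 e : R, 0 < e & [set y | mdist x y < e] `<=` A.
Proof.
rewrite -metricType_numDomainType.filter_from_mdist_nbhs; split.
  by move=> [e e0 eA]; exists e.
by move=> [e e0 eA]; exists e.
Qed.

(** Induction along small steps: a nonempty part of a connected set is
everything as soon as it is stable under steps of a fixed size, because it is
then both open and closed. *)
Lemma connected_uniform_induction (K B : set X) (e : R) :
  connected K -> B `<=` K -> B !=set0 -> 0 < e ->
  (forall z z', B z -> K z' -> mdist z z' < e -> B z') -> K `<=` B.
Proof.
move=> cK BK B0 e0 stepB.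
suff <- : B = K by [].
apply: cK => //.
  exists (\bigcup_(z in B) (ball z e)^°).
    by apply: bigcup_open => z _; exact: open_interior.
  apply/seteqP; split=> [z Bz|z [Kz [b Bb]]].
    split; first exact: BK.
    by exists z => //; apply: nbhsx_ballx.
  by move=> /interior_subset; rewrite ballEmdist => zb; exact: (stepB b).
exists (closure B); first exact: closed_closure.
apply/seteqP; split=> [z Bz|z [Kz clz]].
  by split; [exact: BK | exact: subset_closure].
have [b [Bb]] := clz _ (nbhsx_ballx z _ e0).
by rewrite ballEmdist /= metric_sym => /(stepB _ _ Bb Kz).
Qed.

Lemma connected_finite_set1 (K : set X) a :
  connected K -> finite_set K -> K a -> K = [set a].
Proof.
move=> cK fK Ka; apply/esym/cK; first by exists a.
- exists (~` (K `\ a)).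
    apply: closed_openC.
    have T1 : accessible_space X by exact/hausdorff_accessible/metric_hausdorff.
    by move/accessible_finite_set_closed: T1; apply; exact: finite_setD.
  apply/seteqP; split=> [_ ->|z [Kz]]; first by split=> // -[_]; exact.
  by move=> nz; apply: contrapT => za; apply: nz; split.
- exists [set a]; last by apply/esym/setIidPr => _ ->.
  exact/accessible_closed_set1/hausdorff_accessible/metric_hausdorff.
Qed.

End MetricConnectedness.

Lemma continuous_of_mdist (R : realType) (X Y : metricType R) (h : X -> Y) :
  (forall x e, 0 < e -> exists2 d : R, 0 < d &
    forall y, mdist x y < d -> mdist (h x) (h y) < e) ->
  continuous h.
Proof.
move=> hcont x; apply/metricType_numDomainType.cvgrPdist_lt => e /(hcont x)[d d0 hd].
by apply/nbhs_mdist; exists d.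
Qed.

(** * Finite local intersections *)

Section ExpansiveOfFinite.
Context {R : realType} {X : metricType R} (f : homeo X).

(** A connected subset of [W^u_{c/2}(x)] and [W^s_{c/2}(x)] lies in
[C^s_c(y)] and [C^u_c(y)] for each of its points [y], by the triangle
inequality; a finite connected set is a point. *)
Lemma cw_expansive_of_finite (c : R) : 0 < c ->
  (forall x, finite_set (Cs f c x `&` Cu f c x)) -> cw_expansive f.
Proof.
move=> c0 fin; exists (c / 2); first by rewrite divr_gt0.
move=> x y Wy; set K := connected_component _ y.
have Ky : K y by exact: connected_component_refl.
have cK : connected K by exact: component_connected.
have KW : K `<=` Wu f (c / 2) x `&` Ws f (c / 2) x.
  exact: connected_component_sub.
apply: connected_finite_set1 => //; apply: sub_finite_set (fin y).
have [Wuy Wsy] := Wy.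
move=> z Kz; split; apply: (connected_component_max Ky _ cK Kz) => w /KW [uw sw] n.
- rewrite (le_trans (metric_triangle _ (iter n f x) _))// [leRHS]splitr.
  by rewrite lerD// metric_sym.
- rewrite (le_trans (metric_triangle _ (iter n (homeo_inv f) x) _))// [leRHS]splitr.
  by rewrite lerD// metric_sym.
Qed.

End ExpansiveOfFinite.

(** The properties which the induction on [N] carries. The lower bound is an
explicit injection at every scale, which products preserve. *)
Definition cw_sharp (R : realType) (X : metricType R) (f : homeo X) (M : nat) :=
  [/\ peano_continuum X, cw_local_product_structure f,
   exists2 c : R, 0 < c & forall x, Cs f c x `&` Cu f c x #<= `I_M
   & forall c : R, 0 < c -> exists x (g : nat -> X),
       set_fun `I_M (Cs f c x `&` Cu f c x) g /\ set_inj `I_M g].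

Lemma cw_sharp_hyperbolic (R : realType) (X : metricType R) (f : homeo X) (M : nat) :
  (0 < M)%N -> cw_sharp f M ->
  [/\ compact [set: X], cwM_hyperbolic f M & ~ cwM_expansive f (M - 1)%N].
Proof.
move=> M0 [pX lps [c c0 cM] sharp].
have exf : cw_expansive f.
  apply: (cw_expansive_of_finite c0) => x.
  exact: card_le_finite (cM x) (finite_II _).
split.
- by case: pX.
- by split; [split | split=> //; exists c].
- move=> [_ [e e0 eM]]; have [x [g [gM ginj]]] := sharp e e0.
  have /card_le_trans/(_ (eM x)) : `I_M #<= Cs f e x `&` Cu f e x.
    have [h] : $|{injfun `I_M >-> Cs f e x `&` Cu f e x}|.
      by apply/injfunPex; exists g.
    exact: inj_card_le.
  by rewrite card_le_II -ltnS subn1 prednK// ltnn.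
Qed.

(** * Products *)

Section ProductMetric.
Context {R : realType} {X Y : metricType R}.

Let dist (p q : X * Y) := Num.max (mdist p.1 q.1) (mdist p.2 q.2).

Let dist_ge0 p q : 0 <= dist p q.
Proof. by rewrite /dist le_max mdist_ge0. Qed.

Let dist_positivity p q : dist p q = 0 -> p = q.
Proof.
case: p q => [x y] [x' y']; rewrite /dist /= => d0.
have [/eqP dx /eqP dy] : mdist x x' == 0 /\ mdist y y' == 0.
  by rewrite !eq_le !mdist_ge0 !andbT; apply/andP; rewrite -ge_max d0.
by rewrite (mdist_positivity _ _ dx) (mdist_positivity _ _ dy).
Qed.

Let ballE p r : ball p r = [set q | dist p q < r].
Proof.
rewrite /ball /= /prod_ball !ballEmdist; apply/seteqP.
by split=> q /=; rewrite /dist gt_max => /andP.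
Qed.

(* The product already carries a pseudometric structure, with the product
   topology: only the distance is added to it. *)
HB.instance Definition _ := PseudoMetric_isMetric.Build R (X * Y)%type
  dist_ge0 dist_positivity ballE.

Lemma mdist_prod (p q : X * Y) :
  mdist p q = Num.max (mdist p.1 q.1) (mdist p.2 q.2).
Proof. by []. Qed.

End ProductMetric.

Section ProductTopology.
Context {X Y : topologicalType}.

Lemma continuous_pair (Z : topologicalType) (h : Z -> X) (k : Z -> Y) :
  continuous h -> continuous k -> continuous (fun z => (h z, k z)).
Proof. by move=> ch ck z; apply: cvg_pair; [exact: ch | exact: ck]. Qed.

Lemma connected_setX (A : set X) (B : set Y) :
  connected A -> connected B -> connected (A `*` B).
Proof.
move=> cA cB; have [[b0 Bb0]|/nonemptyPn B0] := pselect (B !=set0); last first.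
  by rewrite B0 setX0; exact: connected0.
have [[a0 Aa0]|/nonemptyPn A0] := pselect (A !=set0); last first.
  by rewrite A0 set0X; exact: connected0.
have hA (b : Y) : connected ((fun a => (a, b)) @` A).
  apply: connected_continuous_connected => //.
  apply: continuous_subspaceT; apply: continuous_pair => a; first exact: cvg_id.
  exact: cst_continuous.
have hB (a : X) : connected ((fun b => (a, b)) @` B).
  apply: connected_continuous_connected => //.
  apply: continuous_subspaceT; apply: continuous_pair => b; last exact: cvg_id.
  exact: cst_continuous.
(* a union of crosses through the common point (a0, b0) *)
have -> : A `*` B = \bigcup_(b in B)
    (((fun a => (a, b)) @` A) `|` ((fun b => (a0, b)) @` B)).
  apply/seteqP; split=> [[a b] [/= Aa Bb]|[a b] [b' Bb' []]].
  - by exists b => //; left; exists a.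
  - by case=> a' Aa' [<- <-].
  - by case=> b'' Bb'' [<- <-].
apply: bigcup_connected => [|b Bb].
  by exists (a0, b0) => b Bb; right; exists b0.
apply: connectedU => //; exists (a0, b); split; last by exists b.
by exists a0.
Qed.

Lemma connected_component_setX (A : set X) (B : set Y) p :
  connected_component (A `*` B) p =
  connected_component A p.1 `*` connected_component B p.2.
Proof.
apply/seteqP; split=> [q [K [Kp KAB cK Kq]]|].
  have cp (Z : topologicalType) (h : X * Y -> Z) : continuous h -> connected (h @` K).
    move=> ch; apply: connected_continuous_connected => //.
    exact: continuous_subspaceT.
  split.
  - exists (fst @` K); last by exists q.
    split; [by exists p | by move=> _ [z /KAB[Az _] <-] |].
    by apply: cp => z; exact: cvg_fst.
  - exists (snd @` K); last by exists q.
    split; [by exists p | by move=> _ [z /KAB[_ Bz] <-] |].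
    by apply: cp => z; exact: cvg_snd.
move=> q [[K [Kp KA cK Kq]] [L [Lp LB cL Lq]]].
exists (K `*` L); last by [].
split; [by [] | by move=> z [Kz Lz]; split; [exact: KA | exact: LB] |].
exact: connected_setX.
Qed.

Lemma locally_connected_prod :
  locally_connected X -> locally_connected Y -> locally_connected (X * Y)%type.
Proof.
move=> lX lY [x y] U [[A B] [/= Ax By] ABU].
have [V [oV Vx cV VA]] := lX x A Ax; have [W [oW Wy cW WB]] := lY y B By.
exists (V `*` W); split; [| by [] | exact: connected_setX |].
  rewrite (_ : V `*` W = (fst @^-1` V) `&` (snd @^-1` W))//.
  by apply: openI; apply: open_comp => // z _; [exact: cvg_fst | exact: cvg_snd].
by move=> [a b] [/= Va Wb]; apply: ABU; split; [exact: VA | exact: WB].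
Qed.

End ProductTopology.

Lemma connected_component_mono (T : topologicalType) (A B : set T) x :
  A `<=` B -> connected_component A x `<=` connected_component B x.
Proof.
by move=> AB y [K [Kx KA cK Ky]]; exists K => //; split=> // z /KA/AB.
Qed.

Lemma Cs_mono (R : realType) (X : metricType R) (f : homeo X) c d x :
  c <= d -> Cs f c x `<=` Cs f d x.
Proof.
by move=> cd; apply: connected_component_mono => y Wy n; exact: le_trans (Wy n) cd.
Qed.

Lemma Cu_mono (R : realType) (X : metricType R) (f : homeo X) c d x :
  c <= d -> Cu f c x `<=` Cu f d x.
Proof.
by move=> cd; apply: connected_component_mono => y Wy n; exact: le_trans (Wy n) cd.
Qed.

Lemma card_le_II_inj T (A : set T) n :
  A #<= `I_n <-> exists2 h : T -> nat, set_fun A `I_n h & set_inj A h.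
Proof.
by rewrite -injfunPex; split=> [/pcard_leP|] // h; exact/pcard_leP.
Qed.

Lemma card_le_setX_II T U (A : set T) (B : set U) m n :
  A #<= `I_m -> B #<= `I_n -> A `*` B #<= `I_(m * n).
Proof.
move=> /card_le_II_inj[h hm hinj] /card_le_II_inj[k kn kinj].
apply/card_le_II_inj; exists (fun p => h p.1 * n + k p.2)%N.
  move=> [a b] [/= /hm ham /kn kbn]; rewrite (@leq_trans (h a * n + n))%N//.
    by rewrite ltn_add2l.
  by rewrite addnC -mulSn leq_mul2r ham orbT.
move=> [a b] [a' b'] /set_mem[/= Aa Bb] /set_mem[/= Aa' Bb'] E.
have n0 : (0 < n)%N by apply: leq_ltn_trans (kn _ Bb).
have := congr1 (divn^~ n) E; rewrite !divnMDl// !divn_small ?(kn _ Bb) ?(kn _ Bb')//.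
rewrite !addn0 => /hinj -> //; rewrite ?inE//.
have := congr1 (modn^~ n) E; rewrite !modnMDl !modn_small ?(kn _ Bb) ?(kn _ Bb')//.
by move=> /kinj -> //; rewrite ?inE.
Qed.

Lemma inj_II_setX T U (A : set T) (B : set U) m n (g : nat -> T) (h : nat -> U) :
  set_fun `I_m A g -> set_inj `I_m g -> set_fun `I_n B h -> set_inj `I_n h ->
  let gh i := (g (i %/ n), h (i %% n))%N in
  set_fun `I_(m * n) (A `*` B) gh /\ set_inj `I_(m * n) gh.
Proof.
move=> gA ginj hB hinj gh.
have n0 i : `I_(m * n)%N i -> (0 < n)%N.
  by rewrite /= lt0n; case: n {gh hB hinj} => //; rewrite muln0.
split=> [i imn|i j].
  by split; [apply: gA; rewrite /= ltn_divLR ?(n0 i) |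
            apply: hB; rewrite /= ltn_mod (n0 i)].
rewrite !inE => imn jmn [gE hE].
have gE' : (i %/ n = j %/ n)%N by apply: ginj => //; rewrite inE /= ltn_divLR ?(n0 i).
have hE' : (i %% n = j %% n)%N by apply: hinj => //; rewrite inE /= ltn_mod (n0 i).
by rewrite (divn_eq i n) gE' hE' -divn_eq.
Qed.

Section ProductDynamics.
Context {R : realType} {X Y : metricType R} (f : homeo X) (g : homeo Y).

Let fg (p : X * Y) := (f p.1, g p.2).
Let fg_inv (p : X * Y) := (homeo_inv f p.1, homeo_inv g p.2).

Let continuous_map_prod (h : X -> X) (k : Y -> Y) :
  continuous h -> continuous k -> continuous (fun p : X * Y => (h p.1, k p.2)).
Proof.
move=> ch ck; apply: continuous_pair => p.
- by apply: (@continuous_comp _ _ _ fst h); [exact: cvg_fst | exact: ch].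
- by apply: (@continuous_comp _ _ _ snd k); [exact: cvg_snd | exact: ck].
Qed.

Let fgK : cancel fg fg_inv.
Proof. by case=> x y; rewrite /fg_inv /= !homeo_funK. Qed.

Let fg_invK : cancel fg_inv fg.
Proof. by case=> x y; rewrite /fg /= !homeo_invK. Qed.

Definition homeo_prod : homeo (X * Y)%type := Homeo fgK fg_invK
  (continuous_map_prod (@homeo_continuous _ f) (@homeo_continuous _ g))
  (continuous_map_prod (@homeo_inv_continuous _ f) (@homeo_inv_continuous _ g)).

Let iter_pair (h : X -> X) (k : Y -> Y) n (p : X * Y) :
  iter n (fun p => (h p.1, k p.2)) p = (iter n h p.1, iter n k p.2).
Proof. by elim: n => [|n /= ->//]; case: p. Qed.

Lemma Cs_prod c p : Cs homeo_prod c p = Cs f c p.1 `*` Cs g c p.2.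
Proof.
rewrite /Cs -connected_component_setX; congr connected_component.
apply/seteqP; split=> [q Wq|q [Wq1 Wq2] n].
  by split=> n; have := Wq n; rewrite !iter_pair mdist_prod ge_max => /andP[].
by rewrite !iter_pair mdist_prod ge_max; apply/andP; split; [exact: Wq1|exact: Wq2].
Qed.

Lemma Cu_prod c p : Cu homeo_prod c p = Cu f c p.1 `*` Cu g c p.2.
Proof.
rewrite /Cu -connected_component_setX; congr connected_component.
apply/seteqP; split=> [q Wq|q [Wq1 Wq2] n].
  by split=> n; have := Wq n; rewrite !iter_pair mdist_prod ge_max => /andP[].
by rewrite !iter_pair mdist_prod ge_max; apply/andP; split; [exact: Wq1|exact: Wq2].
Qed.

Let CsCu_prod c p : Cs homeo_prod c p `&` Cu homeo_prod c p =
  (Cs f c p.1 `&` Cu f c p.1) `*` (Cs g c p.2 `&` Cu g c p.2).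
Proof. by rewrite Cs_prod Cu_prod setXI. Qed.

Lemma cw_sharp_prod M K : cw_sharp f M -> cw_sharp g K ->
  cw_sharp homeo_prod (M * K)%N.
Proof.
move=> [[cX kX lX] lpsf [c c0 cM] sharpf] [[cY kY lY] lpsg [d d0 dK] sharpg].
split.
- split; rewrite -?setXTT; [exact: compact_setX | exact: connected_setX |].
  exact: locally_connected_prod.
- move=> e e0; have [a a0 aP] := lpsf e e0; have [b b0 bP] := lpsg e e0.
  exists (Num.min a b); first by rewrite lt_min a0.
  move=> p q; rewrite mdist_prod gt_max !lt_min => /andP[/andP[pq1 _] /andP[_ pq2]].
  have [x [xs xu]] := aP _ _ pq1; have [y [ys yu]] := bP _ _ pq2.
  by exists (x, y); rewrite Cs_prod Cu_prod.
- exists (Num.min c d); first by rewrite lt_min c0.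
  move=> p; rewrite CsCu_prod.
  apply: card_le_setX_II.
  + apply: card_le_trans (cM p.1); apply: subset_card_le.
    by apply: setISS; [apply: Cs_mono | apply: Cu_mono]; rewrite ge_min lexx.
  + apply: card_le_trans (dK p.2); apply: subset_card_le.
    by apply: setISS; [apply: Cs_mono | apply: Cu_mono]; rewrite ge_min lexx orbT.
- move=> e e0; have [x [u [uM uinj]]] := sharpf e e0.
  have [y [v [vK vinj]]] := sharpg e e0.
  exists (x, y), (fun i => (u (i %/ K), v (i %% K))%N); rewrite CsCu_prod.
  exact: inj_II_setX.
Qed.

End ProductDynamics.

(** * The golden lattice and the half-turn group *)

Section GoldenLattice.
Context {R : realType}.
Implicit Types p q v w : R * R.

Definition phi : R := (1 + Num.sqrt 5) / 2.
Definition psi : R := (1 - Num.sqrt 5) / 2.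

Let sqrt5 : (Num.sqrt 5 : R) ^+ 2 = 5 /\ 2 < (Num.sqrt 5 : R) < 3.
Proof.
have s2 : (Num.sqrt 5 : R) ^+ 2 = 5 by rewrite sqr_sqrtr// ler0n.
by split=> //; have := sqrtr_ge0 (5 : R); move: s2; nra.
Qed.

Lemma phiD_psi : phi + psi = 1.
Proof. by rewrite /phi /psi; lra. Qed.

Lemma phiM_psi : phi * psi = -1.
Proof.
by rewrite /phi /psi; have [s2 _] := sqrt5; lra.
Qed.

Lemma phi_bounds : 3 / 2 < phi < 2.
Proof. by have [_] := sqrt5; rewrite /phi; lra. Qed.

Lemma psiE : psi = 1 - phi. Proof. by rewrite -phiD_psi; ring. Qed.

Lemma phi_sqr : phi * phi = phi + 1.
Proof. by have := phiM_psi; rewrite psiE; lra. Qed.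

Lemma psi_norm : `|psi| < 1.
Proof. by rewrite ltr_norml psiE; have := phi_bounds; lra. Qed.

Lemma phi_norm : `|phi| = phi.
Proof. by rewrite ger0_norm//; have := phi_bounds; lra. Qed.

Definition lattice : set (R * R) :=
  [set v | exists a b : int, v = (a%:~R + b%:~R * phi, a%:~R + b%:~R * psi)].

Lemma latticeB v w : lattice v -> lattice w -> lattice (v - w).
Proof.
move=> [a [b ->]] [a' [b' ->]]; exists (a - a'), (b - b').
by congr pair; rewrite /= !rmorphB /=; ring.
Qed.

Lemma lattice0 : lattice 0.
Proof. by exists 0, 0; rewrite !mul0r !addr0. Qed.

Lemma latticeN v : lattice v -> lattice (- v).
Proof. by move=> /(latticeB lattice0); rewrite sub0r. Qed.

Lemma latticeD v w : lattice v -> lattice w -> lattice (v + w).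
Proof. by move=> lv /latticeN; rewrite -{2}[w]opprK; exact: latticeB. Qed.

Lemma norm2_lt p (r : R) : (`|p| < r) = (`|p.1| < r) && (`|p.2| < r).
Proof. by rewrite prod_normE gt_max. Qed.

Lemma norm2_le p (r : R) : (`|p| <= r) = (`|p.1| <= r) && (`|p.2| <= r).
Proof. by rewrite prod_normE ge_max. Qed.

(** [4 (a^2 + a b - b^2) = (2 a + b)^2 - 5 b^2], and [5] has even multiplicity
in a square. *)
Lemma golden_form_eq0 (a b : int) : a * a + a * b - b * b = 0 -> a = 0 /\ b = 0.
Proof.
move=> ab0; set c := 2 * a + b.
have c5 : (`|c| ^ 2 = 5 * `|b| ^ 2)%N.
  have : c * c = 5 * (b * b) by rewrite /c; lia.
  by move/(congr1 absz); rewrite !abszM -!mulnn.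
have b0 : b = 0.
  apply/eqP; rewrite -absz_eq0; apply/negPn; rewrite -lt0n; apply/negP => bp.
  have := congr1 (logn 5) c5.
  rewrite lognM ?expn_gt0 ?bp// !lognX (_ : logn 5 5 = 1%N)//.
  by move/(congr1 odd); rewrite oddD !oddM.
by split=> //; move: ab0; rewrite b0; nia.
Qed.

(** The product of the two coordinates of a lattice vector is its field norm
[a^2 + a b - b^2], an integer. *)
Lemma lattice_discrete v : lattice v -> `|v| < 1 -> v = 0.
Proof.
move=> [a [b vE]]; rewrite norm2_lt => /andP[v1 v2].
have prodE : v.1 * v.2 = (a * a + a * b - b * b)%:~R.
  rewrite vE /= rmorphB rmorphD !rmorphM /=.
  apply/eqP; rewrite -subr_eq0; set A : R := a%:~R; set B : R := b%:~R.
  rewrite (_ : _ - _ = A * B * (phi + psi - 1) + B * B * (phi * psi + 1)); last by ring.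
  by rewrite phiD_psi phiM_psi subrr addNr !mulr0 addr0.
have : `|v.1 * v.2| < 1 by rewrite normrM; apply: mulr_ilt1.
rewrite prodE -intr_norm -(mulr1z 1) ltr_int => small.
have [|a0 b0] := @golden_form_eq0 a b; first by lia.
by rewrite vE a0 b0 !mul0r !addr0.
Qed.

Definition orbit_eq p q := exists2 v, lattice v & q = v + p \/ q = v - p.

Lemma orbit_eq_refl p : orbit_eq p p.
Proof. by exists 0; [exact: lattice0 | left; rewrite add0r]. Qed.

Lemma orbit_eq_sym p q : orbit_eq p q -> orbit_eq q p.
Proof.
move=> [v lv [->|->]]; last by exists v => //; right; rewrite opprB addrC subrK.
by exists (- v); [exact: latticeN | left; rewrite addKr].
Qed.

Lemma orbit_eq_trans q p r : orbit_eq p q -> orbit_eq q r -> orbit_eq p r.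
Proof.
move=> [v lv [->|->]] [w lw [->|->]].
- by exists (w + v); [exact: latticeD | left; rewrite addrA].
- by exists (w - v); [exact: latticeB | right; rewrite opprD addrA].
- by exists (w + v); [exact: latticeD | right; rewrite addrA].
- by exists (w - v); [exact: latticeB | left; rewrite opprB addrA addrAC].
Qed.

(** The group acts by isometries, so in the quotient a chosen lift of one point
can be kept while the other is lifted nearby. *)
Lemma orbit_eq_isometry p p' q : orbit_eq p p' ->
  exists2 q', orbit_eq q q' & `|p' - q'| = `|p - q|.
Proof.
move=> [v lv [->|->]].
- exists (v + q); first by exists v => //; left.
  by rewrite opprD addrACA subrr add0r.
- exists (v - q); first by exists v => //; right.
  by rewrite opprB addrC addrA subrK distrC addrC.
Qed.

(** Small balls contain at most two points of an orbit: two close points which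
differ by a translation coincide, and the composite of two half turns is a
translation. *)
Lemma orbit_eq_three p a b : orbit_eq p a -> orbit_eq p b ->
  `|p - a| < 1 -> `|p - b| < 1 -> `|a - b| < 1 -> [\/ p = a, p = b | a = b].
Proof.
have small v : lattice v -> `|v| < 1 -> forall q, v + q = q.
  by move=> lv v1 q; rewrite (lattice_discrete lv v1) add0r.
move=> [v lv [->|->]].
  by rewrite opprD addrCA subrr addr0 normrN => _ v1 _ _; constructor 1; rewrite small.
move=> [w lw [->|->]] _.
  by rewrite opprD addrCA subrr addr0 normrN => w1 _; constructor 2; rewrite small.
move=> _; rewrite opprB addrA subrK => vw1; constructor 3.
by apply/eqP; rewrite -subr_eq0 opprB addrA subrK (lattice_discrete (latticeB lv lw)).
Qed.

(** As at most two points of an orbit lie near [p], a condition that they satisfy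
up to arbitrarily small errors is satisfied exactly by one of them. *)
Lemma orbit_limit (h : R * R -> R) p q :
  (forall a, 0 <= h a) ->
  (forall e : R, 0 < e -> exists a, [/\ orbit_eq q a, `|p - a| < 1 / 2 & h a < e]) ->
  exists a, [/\ orbit_eq q a, `|p - a| < 1 / 2 & h a = 0].
Proof.
move=> h0 happ; apply: contrapT => none.
have hgt a : orbit_eq q a -> `|p - a| < 1 / 2 -> 0 < h a.
  move=> qa pa; rewrite lt_neqAle h0 andbT; apply/eqP => ha.
  by apply: none; exists a.
have close a b : `|p - a| < 1 / 2 -> `|p - b| < 1 / 2 -> `|a - b| < 1.
  move=> pa pb; rewrite (le_lt_trans (ler_distD p _ _))//.
  by rewrite distrC [ltRHS]splitr ltrD.
have [a [qa pa _]] := happ 1 ltr01.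
have [b [qb pb hb]] := happ _ (hgt _ qa pa).
have [c [qc pc hc]] := happ _ (hgt _ qb pb).
have qab := orbit_eq_trans (orbit_eq_sym qa) qb.
have qac := orbit_eq_trans (orbit_eq_sym qa) qc.
have [ab|ac|bc] := orbit_eq_three qab qac (close _ _ pa pb) (close _ _ pa pc)
  (close _ _ pb pc).
- by move: hb; rewrite ab ltxx.
- by move: (lt_trans hc hb); rewrite ac ltxx.
- by move: hc; rewrite bc ltxx.
Qed.

End GoldenLattice.

(** * The pillowcase *)

Section Quotient.
Variable R : realType.

Definition orbit_rel (p q : R * R) : bool := `[< orbit_eq p q >].

Lemma orbit_rel_equiv : equiv_class_of orbit_rel.
Proof.
split=> [p|p q|q p r]; first by apply/asboolP; exact: orbit_eq_refl.
  by apply/asboolP/asboolP; exact: orbit_eq_sym.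
by move=> /asboolP pq /asboolP qr; apply/asboolP; exact: orbit_eq_trans pq qr.
Qed.

Canonical orbit_equiv := EquivRelPack orbit_rel_equiv.

Definition pillow : Type := {eq_quot orbit_equiv}%qT.
HB.instance Definition _ := Choice.on pillow.

Definition ppi (p : R * R) : pillow := (\pi_({eq_quot orbit_equiv}) p)%qT.
Definition plift (x : pillow) : R * R := repr (x : {eq_quot orbit_equiv})%qT.

Lemma pliftK x : ppi (plift x) = x. Proof. exact: reprK. Qed.

Lemma ppiP p q : ppi p = ppi q <-> orbit_eq p q.
Proof. by split=> [/eqmodP/asboolP|pq] //; apply/eqmodP/asboolP. Qed.

(* All pairs of lifts are used, which makes the symmetry of the distance
   evident. *)
Let dists (x y : pillow) : set R :=
  [set r | exists p q, [/\ ppi p = x, ppi q = y & r = `|p - q|]].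

Let pdist x y : R := inf (dists x y).

Let dists_inf x y : has_inf (dists x y).
Proof.
split; last by exists 0 => _ [p [q [_ _ ->]]].
by exists `|plift x - plift y|, (plift x), (plift y); rewrite !pliftK.
Qed.

Let pdist_le p q : pdist (ppi p) (ppi q) <= `|p - q|.
Proof. by apply: ge_inf; [case: (dists_inf (ppi p) (ppi q)) | exists p, q]. Qed.

Let pdist_lt p y r : pdist (ppi p) y < r ->
  exists2 q, ppi q = y & `|p - q| < r.
Proof.
move=> /(inf_lt (dists_inf _ _).1)[_ [p' [q' [pp' <- ->]]]] pq'.
have [q qq' qE] := orbit_eq_isometry q' ((ppiP _ _).1 pp').
by exists q; [apply/esym/ppiP | rewrite qE].
Qed.

Let pdist_xx x : pdist x x = 0.
Proof.
apply/eqP; rewrite eq_le; apply/andP; split.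
  by have := pdist_le (plift x) (plift x); rewrite pliftK subrr normr0.
by apply: lb_le_inf; [case: (dists_inf x x) | move=> _ [p [q [_ _ ->]]]].
Qed.

Let pdist_positivity x y : pdist x y = 0 -> x = y.
Proof.
rewrite -(pliftK x) -(pliftK y); set p := plift x; set q := plift y => d0.
have [||a [qa _ /eqP]] := @orbit_limit R (fun a => `|p - a|) p q.
- by [].
- move=> e e0; have /pdist_lt[a aq] : pdist (ppi p) (ppi q) < Num.min e (1 / 2).
    by rewrite d0 lt_min e0 divr_gt0.
  rewrite lt_min => /andP[ae a2]; exists a; split=> //.
  exact/ppiP/esym.
- by rewrite normr_eq0 subr_eq0 => /eqP ->; apply/esym/ppiP.
Qed.

Let pdist_sym x y : pdist x y = pdist y x.
Proof.
congr inf; apply/seteqP; split=> _ [p [q [px qy ->]]];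
  by exists q, p; rewrite distrC.
Qed.

Let pdist_triangle y x z : pdist x z <= pdist x y + pdist y z.
Proof.
apply/ler_addgt0Pr => e e0.
have xy : pdist x y < pdist x y + e / 2 by rewrite ltrDl divr_gt0.
have yz : pdist y z < pdist y z + e / 2 by rewrite ltrDl divr_gt0.
have [q qy pq] : exists2 q, ppi q = y & `|plift x - q| < pdist x y + e / 2.
  by apply: pdist_lt; rewrite pliftK.
rewrite -{1}qy in yz; have [r rz qr] := pdist_lt yz.
rewrite -(pliftK x) -rz (le_trans (pdist_le _ _))//.
rewrite (le_trans (ler_distD q _ _))// pliftK rz.
by rewrite [leRHS](_ : _ = (pdist x y + e / 2) + (pdist y z + e / 2)) ?lerD ?ltW//; lra.
Qed.

HB.instance Definition _ := isMetric.Build R pillow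
  pdist_xx pdist_positivity pdist_sym pdist_triangle.

Lemma mdist_ppi p q : mdist (ppi p) (ppi q) <= `|p - q|.
Proof. exact: pdist_le. Qed.

Lemma mdist_lift p y r : mdist (ppi p) y < r -> exists2 q, ppi q = y & `|p - q| < r.
Proof. exact: pdist_lt. Qed.

Lemma ppi_continuous : continuous ppi.
Proof.
move=> p; apply/metricType_numDomainType.cvgrPdist_lt => e e0.
near=> q; rewrite (le_lt_trans (mdist_ppi p q))//.
Unshelve. all: by end_near. Qed.

End Quotient.

Section PillowTopology.
Variable R : realType.

(** A fundamental domain: subtracting the integer parts of the coordinates of
[p] in the lattice basis leaves [a + b phi] and [a + b psi] with [a] and [b]
between [0] and [1]. *)
Lemma golden_box (p : R * R) :
  exists q, [/\ orbit_eq p q, `|q.1| <= 3 & `|q.2| <= 3].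
Proof.
have [/andP[phi1 phi2]] := @phi_bounds R.
set b := (p.1 - p.2) / (phi - psi); set a := p.1 - b * phi.
have dne : phi - psi != 0 :> R by rewrite psiE; lra.
have pE : p = (a + b * phi, a + b * psi).
  rewrite (surjective_pairing p); congr pair; rewrite /a /b; first by ring.
  by field.
have frac (x : R) : 0 <= x - (Num.floor x)%:~R <= 1.
  have /andP[fx xf] := floor_itv x; rewrite subr_ge0 fx lerBlDl.
  by rewrite intrD in xf; exact: ltW.
have := frac a; have := frac b.
set a' := a - _; set b' := b - _ => /andP[b0 b1] /andP[a0 a1].
exists (a' + b' * phi, a' + b' * psi); split => /=.
- exists (- ((Num.floor a)%:~R + (Num.floor b)%:~R * phi,
             (Num.floor a)%:~R + (Num.floor b)%:~R * psi)).
    by apply: latticeN; exists (Num.floor a), (Num.floor b).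
  by left; rewrite pE; congr pair; rewrite /a' /b' /=; ring.
- rewrite (le_trans (ler_normD _ _))// normrM !ger0_norm//; try lra.
  have : b' * phi <= 1 * 2 by apply: ler_pM => //; lra.
  lra.
- rewrite (le_trans (ler_normD _ _))// normrM (ger0_norm a0) (ger0_norm b0).
  have : b' * `|psi| <= 1 * 1 by apply: ler_pM => //; exact/ltW/psi_norm.
  lra.
Qed.

Lemma pillow_compact : compact [set: pillow R].
Proof.
pose box := `[-3, 3]%classic `*` `[-3, 3]%classic : set (R * R).
have -> : [set: pillow R] = @ppi R @` box.
  apply/seteqP; split=> // x _; have [q [pq q1 q2]] := golden_box (plift x).
  exists q; last by rewrite -(pliftK x); exact/esym/ppiP.
  by split; rewrite /= in_itv /= -ler_norml.
apply: continuous_compact; first exact/continuous_subspaceT/ppi_continuous.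
by apply: compact_setX; exact: segment_compact.
Qed.

Definition plane_segment (p q : R * R) : set (R * R) :=
  (fun t : R => p + t *: (q - p)) @` `[0, 1].

Lemma plane_segment_connected p q : connected (plane_segment p q).
Proof.
apply: connected_continuous_connected; first exact: segment_connected.
apply: continuous_subspaceT => t.
apply: cvgD; first exact: cvg_cst.
by apply: cvgZr_tmp; exact: cvg_id.
Qed.

Lemma ppi_connected (A : set (R * R)) : connected A -> connected (@ppi R @` A).
Proof.
move=> cA; apply: connected_continuous_connected => //.
exact/continuous_subspaceT/ppi_continuous.
Qed.

Lemma connected_star (T : topologicalType) (A : set T) a :
  A a -> (forall x, A x -> exists K, [/\ connected K, K a, K x & K `<=` A]) ->
  connected A.
Proof.
move=> Aa star; have -> : A = connected_component A a; last exact: component_connected.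
apply/seteqP; split=> [x /star[K [cK Ka Kx KA]]|]; first by exists K.
exact: connected_component_sub.
Qed.

Lemma plane_segment_ends p q : plane_segment p q p /\ plane_segment p q q.
Proof.
split; first by exists 0; rewrite /= ?in_itv /= ?lexx ?ler01// scale0r addr0.
by exists 1; rewrite /= ?in_itv /= ?lexx ?ler01// scale1r addrC subrK.
Qed.

Lemma ball_ppi p e : ball (ppi p) e = @ppi R @` [set q | `|p - q| < e].
Proof.
rewrite ballEmdist; apply/seteqP; split=> [y /mdist_lift[q qy pq]|_ [q pq <-]].
  by exists q.
by rewrite /= (le_lt_trans (mdist_ppi _ _)).
Qed.

Lemma pillow_connected : connected [set: pillow R].
Proof.
apply: (@connected_star _ _ (ppi 0)) => // x _.
exists (@ppi R @` plane_segment 0 (plift x)); split=> //.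
- exact/ppi_connected/plane_segment_connected.
- by exists 0 => //; exact: (plane_segment_ends _ _).1.
- by exists (plift x); [exact: (plane_segment_ends _ _).2 | rewrite pliftK].
Qed.

Lemma pillow_locally_connected : locally_connected (pillow R).
Proof.
move=> x U /nbhs_mdist[e e0 eU]; exists (ball x e); split.
- rewrite openE => y; rewrite ballEmdist /= => xy.
  apply/nbhs_mdist; exists (e - mdist x y); first by rewrite subr_gt0.
  move=> z /=; rewrite ltrBrDl; exact/le_lt_trans/metric_triangle.
- exact: ballxx.
- rewrite -(pliftK x) ball_ppi; apply: ppi_connected; set p := plift x.
  apply: (@connected_star _ _ p) => [|q pq]; first by rewrite /= subrr normr0.
  exists (plane_segment p q); split; [exact: plane_segment_connected |
    exact: (plane_segment_ends _ _).1 | exact: (plane_segment_ends _ _).2 |].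
  move=> _ [t /= + <-]; rewrite in_itv /= => /andP[t0 t1].
  rewrite /= opprD addrA subrr add0r normrN normrZ ger0_norm// distrC.
  by apply: le_lt_trans pq; rewrite ler_piMl.
- by rewrite ballEmdist.
Qed.

Lemma pillow_peano : peano_continuum (pillow R).
Proof.
split; [exact: pillow_compact | exact: pillow_connected |].
exact: pillow_locally_connected.
Qed.

End PillowTopology.

(** * Continua of companion orbits lie in leaves *)

(** The stable sets of the map and those of its inverse are treated at the same
time: [T] is a lift of the map, and [l] the coordinate which it expands. The
leaves are the lines on which [l] is constant. *)
Section LinearDynamics.
Variables (R : realType) (T : R * R -> R * R) (l : R * R -> R).
Hypothesis TB : {morph T : p q / p - q}.
Hypothesis lZ : forall (t : R) p, l (t *: p) = t * l p.
Hypothesis T_lattice : forall v, lattice v -> lattice (T v).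
Hypothesis T_lipschitz : forall p, `|T p| <= 2 * `|p|.
Hypothesis l_norm : forall p, `|l p| <= `|p|.
Hypothesis l_expands : forall p, `|l (T p)| = phi * `|l p|.
Hypothesis T_contracts : forall p, l p = 0 -> `|T p| <= `|p|.

Definition descent (x : pillow R) : pillow R := ppi (T (plift x)).

Let T0 : T 0 = 0. Proof. by have := TB 0 0; rewrite !subrr. Qed.
Let TN p : T (- p) = - T p. Proof. by have := TB 0 p; rewrite T0 !sub0r. Qed.
Let TD p q : T (p + q) = T p + T q. Proof. by rewrite -[q in LHS]opprK TB TN opprK. Qed.

Lemma orbit_eq_lin p q : orbit_eq p q -> orbit_eq (T p) (T q).
Proof.
move=> [v lv pq]; exists (T v); first exact: T_lattice.
by case: pq => ->; [left; rewrite TD | right; rewrite TB].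
Qed.

Lemma descentE p : descent (ppi p) = ppi (T p).
Proof. by apply/ppiP/orbit_eq_lin/ppiP; rewrite pliftK. Qed.

Lemma descent_continuous : continuous descent.
Proof.
apply: continuous_of_mdist => x e e0; exists (e / 2); first by rewrite divr_gt0.
move=> y /=; rewrite -(pliftK x) => /mdist_lift[q <- xq].
rewrite !descentE (le_lt_trans (mdist_ppi _ _))// -TB.
by rewrite (le_lt_trans (T_lipschitz _))// mulrC -ltr_pdivlMr.
Qed.

Lemma iter_descent n p : iter n descent (ppi p) = ppi (iter n T p).
Proof. by elim: n => //= n ->; rewrite descentE. Qed.

Lemma iterB n : {morph iter n T : p q / p - q}.
Proof. by elim: n => // n IH p q; rewrite /= IH TB. Qed.

Lemma iter_lipschitz n p : `|iter n T p| <= 2 ^+ n * `|p|.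
Proof.
elim: n => [|n IH] /=; first by rewrite expr0 mul1r.
by rewrite (le_trans (T_lipschitz _))// exprS -mulrA ler_pM2l.
Qed.

Lemma iter_expands n p : `|l (iter n T p)| = phi ^+ n * `|l p|.
Proof.
elim: n => [|n IH] /=; first by rewrite expr0 mul1r.
by rewrite l_expands IH exprS mulrA.
Qed.

Lemma iter_contracts n p : l p = 0 -> `|iter n T p| <= `|p|.
Proof.
move=> lp; elim: n => //= n IH; rewrite (le_trans _ IH)// T_contracts//.
by apply/normr0_eq0; rewrite iter_expands lp normr0 mulr0.
Qed.

Definition shadow (c : R) (x : pillow R) : set (pillow R) :=
  [set y | forall n : nat, mdist (iter n descent x) (iter n descent y) <= c].

Lemma leaf_sub_component c p q : l (p - q) = 0 -> `|p - q| <= c ->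
  connected_component (shadow c (ppi p)) (ppi p) (ppi q).
Proof.
move=> lpq pqc; exists (@ppi R @` plane_segment p q).
  split; last exact/ppi_connected/plane_segment_connected.
    by exists p => //; exact: (plane_segment_ends _ _).1.
  move=> _ [_ [t /= + <-] <-] n; rewrite in_itv /= => /andP[t0 t1].
  rewrite !iter_descent (le_trans (mdist_ppi _ _))// -iterB.
  have -> : p - (p + t *: (q - p)) = t *: (p - q).
    by rewrite opprD addrA subrr add0r -scalerN opprB.
  rewrite (le_trans (iter_contracts _ _)) ?lZ ?lpq ?mulr0//.
  rewrite normrZ ger0_norm// (le_trans _ pqc)//.
  by rewrite ler_piMl.
by exists q => //; exact: (plane_segment_ends _ _).2.
Qed.

(** The key lemma; see the explanation at the top. The constants [2 c] and
[5 c] close up as follows: if [a] and [b] are lifts of the [m]-th image of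
[ppi p] at distance less than [2 c] from two points that are [c]-close to each
other, then [a] and [b] are at distance less than [5 c]. The bound [28 c <= 1] ensures
that all the orbit points compared are within the range of [orbit_eq_three]. *)
Lemma component_sub_leaf c p z : 0 < c -> 28 * c <= 1 ->
  connected_component (shadow c (ppi p)) (ppi p) z ->
  exists q, [/\ ppi q = z, `|p - q| < 1 / 2 & l (p - q) = 0].
Proof.
move=> c0 c1; set K := connected_component _ _ => Kz.
have cK : connected K by exact: component_connected.
have KW : K `<=` shadow c (ppi p) by exact: connected_component_sub.
have phi0 : 0 < phi :> R by have /andP[] := @phi_bounds R; lra.
(* the m-th image of q is near a lift of the m-th image of ppi p, and this lift
   is the m-th image of p or its only close companion *)
pose near m q := exists a, [/\ orbit_eq (iter m T p) a, `|iter m T p - a| < 5 * c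
   & `|a - iter m T q| < 2 * c].
pose B n := [set y | K y /\ exists2 q, ppi q = y & forall m, (m <= n)%N -> near m q].
have Kp : K (ppi p).
  apply: connected_component_refl => n; rewrite mdistxx; exact: ltW.
(* T doubles lengths at most, so that steps of size c / 2^n remain of size c
   during n iterations *)
have KB n : K `<=` B n.
  apply: (@connected_uniform_induction _ _ _ _ (c / 2 ^+ n)) => //.
  - by move=> y [].
  - exists (ppi p); split=> //; exists p => // m _; exists (iter m T p).
    by rewrite subrr normr0 !mulr_gt0//; split=> //; exact: orbit_eq_refl.
  - by rewrite divr_gt0// exprn_gt0.
  move=> y y' [Ky [q <- nearq]] Ky' /mdist_lift[q' q'y qq']; split=> //.
  exists q' => // m mn; have [a [pa pac aq]] := nearq m mn.
  have qq'm : `|iter m T q - iter m T q'| < c.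
    rewrite -iterB (le_lt_trans (iter_lipschitz _ _))//.
    rewrite ltr_pdivlMr ?exprn_gt0// mulrC in qq'.
    apply: le_lt_trans qq'; rewrite ler_wpM2r// ler_weXn2l//; lra.
  have /mdist_lift[b pb bq'] : mdist (ppi (iter m T q')) (ppi (iter m T p)) < 2 * c.
    rewrite metric_sym -!iter_descent q'y.
    by rewrite (le_lt_trans (KW _ Ky' m))//; lra.
  have {}pb : orbit_eq (iter m T p) b by exact/ppiP/esym.
  have ab : `|a - b| < 5 * c.
    have := ler_distD (iter m T q) a b; have := ler_distD (iter m T q') (iter m T q) b.
    lra.
  exists b; split=> //; last by rewrite distrC.
  have pb1 : `|iter m T p - b| < 1.
    by have := ler_distD a (iter m T p) b; lra.
  have [pa1 ab1] : `|iter m T p - a| < 1 /\ `|a - b| < 1 by split; lra.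
  by have [->|->|<-] := orbit_eq_three pa pb pa1 pb1 ab1;
    rewrite ?subrr ?normr0 ?mulr_gt0.
have [] := @orbit_limit R (fun q => `|l (p - q)|) p (plift z).
- by [].
- move=> e e0.
  have [n ne] : exists n, 1 / 2 < e * phi ^+ n.
    have : `|phi^-1 : R| < 1.
      by rewrite normfV phi_norm invf_lt1//; have /andP[] := @phi_bounds R; lra.
    move=> /cvg_expr/cvgr0_norm_lt/(_ e e0)[n _ /(_ n (leqnn n))].
    rewrite normrX normfV phi_norm exprVn invf_plt ?posrE ?exprn_gt0// => ne.
    exists n; have : 1 < e * phi ^+ n by rewrite mulrC -ltr_pdivrMr// mul1r.
    lra.
  have [_ [q qz nearq]] := KB n z Kz; exists q.
  have close m : (m <= n)%N -> `|iter m T p - iter m T q| < 1 / 2.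
    move=> /nearq[a [_ pa aq]]; have := ler_distD a (iter m T p) (iter m T q); lra.
  split; first by apply/ppiP; rewrite pliftK.
    exact: (close 0%N).
  rewrite -(ltr_pM2r (exprn_gt0 n phi0)) [ltLHS]mulrC -iter_expands iterB.
  exact: le_lt_trans (l_norm _) (lt_trans (close n _) ne).
move=> q [/ppiP qz pq /eqP lq]; exists q; rewrite -qz pliftK; split=> //.
by apply/eqP; rewrite -normr_eq0.
Qed.

End LinearDynamics.

(** * The pseudo-Anosov map of the pillowcase *)

Section PillowMap.
Variable R : realType.
Implicit Types p q v : R * R.

Definition stretch1 p : R * R := (phi * p.1, psi * p.2).
Definition stretch2 p : R * R := (psi * p.1, phi * p.2).

Let psi_le1 : `|psi : R| <= 1. Proof. exact/ltW/psi_norm. Qed.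
Let phi_le2 : `|phi : R| <= 2.
Proof. by rewrite phi_norm; have /andP[] := @phi_bounds R; lra. Qed.
Let psi_le2 : `|psi : R| <= 2. Proof. by rewrite (le_trans psi_le1)// ler1n. Qed.

Lemma stretch1B : {morph stretch1 : p q / p - q}.
Proof. by move=> p q; rewrite /stretch1 /= !mulrBr. Qed.

Lemma stretch2B : {morph stretch2 : p q / p - q}.
Proof. by move=> p q; rewrite /stretch2 /= !mulrBr. Qed.

Lemma stretch1_lattice v : lattice v -> lattice (stretch1 v).
Proof.
move=> [a [b ->]]; exists b, (a + b); rewrite /stretch1 /= rmorphD /=.
have phi2 : phi * phi = phi + 1 :> R := phi_sqr.
have psi2 : psi * psi = psi + 1 :> R by rewrite psiE; lra.
by congr pair; rewrite mulrDr mulrCA ?phi2 ?psi2; ring.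
Qed.

Lemma stretch2_lattice v : lattice v -> lattice (stretch2 v).
Proof.
move=> [a [b ->]]; exists (a - b), (- a); rewrite /stretch2 /= rmorphB rmorphN /=.
have phi_psi : phi * psi = -1 :> R := phiM_psi.
have psi_phi : psi * phi = -1 :> R by rewrite mulrC.
congr pair; rewrite mulrDr mulrCA ?phi_psi ?psi_phi psiE; ring.
Qed.

Lemma fst_norm p : `|p.1| <= `|p|.
Proof. by have := lexx `|p|; rewrite {1}norm2_le => /andP[]. Qed.

Lemma snd_norm p : `|p.2| <= `|p|.
Proof. by have := lexx `|p|; rewrite {1}norm2_le => /andP[]. Qed.

Lemma stretch1_lipschitz p : `|stretch1 p| <= 2 * `|p|.
Proof.
rewrite norm2_le /= (normrM phi) (normrM psi).
by apply/andP; split; apply: ler_pM => //;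
  by [exact: fst_norm | exact: snd_norm].
Qed.

Lemma stretch2_lipschitz p : `|stretch2 p| <= 2 * `|p|.
Proof.
rewrite norm2_le /= (normrM phi) (normrM psi).
by apply/andP; split; apply: ler_pM => //;
  by [exact: fst_norm | exact: snd_norm].
Qed.

Lemma stretch1_expands p : `|(stretch1 p).1| = phi * `|p.1|.
Proof. by rewrite normrM phi_norm. Qed.

Lemma stretch2_expands p : `|(stretch2 p).2| = phi * `|p.2|.
Proof. by rewrite normrM phi_norm. Qed.

Lemma stretch1_contracts p : p.1 = 0 -> `|stretch1 p| <= `|p|.
Proof.
move=> p0; rewrite norm2_le /= p0 mulr0 normr0 normr_ge0 /= normrM.
by rewrite (le_trans _ (snd_norm p))// ler_piMl.
Qed.

Lemma stretch2_contracts p : p.2 = 0 -> `|stretch2 p| <= `|p|.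
Proof.
move=> p0; rewrite norm2_le /= p0 mulr0 normr0 normr_ge0 andbT normrM.
by rewrite (le_trans _ (fst_norm p))// ler_piMl.
Qed.

Let descent1E p := descentE stretch1B stretch1_lattice p.
Let descent2E p := descentE stretch2B stretch2_lattice p.

Lemma ppiN p : ppi (- p) = ppi p.
Proof. by apply/esym/ppiP; exists 0; [exact: lattice0 | right; rewrite sub0r]. Qed.

Let phi_psiM (x : R) : phi * (psi * x) = - x.
Proof. by rewrite mulrA phiM_psi mulN1r. Qed.
Let psi_phiM (x : R) : psi * (phi * x) = - x.
Proof. by rewrite mulrA [psi * _]mulrC phiM_psi mulN1r. Qed.

(* The two stretches compose to the half turn p |-> - p, since phi psi = -1. *)
Let pillowK : cancel (descent stretch1) (descent stretch2).
Proof.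
move=> x; rewrite -(pliftK x) descent1E descent2E -[RHS]ppiN.
by rewrite /stretch2 /= psi_phiM phi_psiM.
Qed.

Let pillow_invK : cancel (descent stretch2) (descent stretch1).
Proof.
move=> x; rewrite -(pliftK x) descent2E descent1E -[RHS]ppiN.
by rewrite /stretch1 /= psi_phiM phi_psiM.
Qed.

Definition pillow_map : homeo (pillow R) := Homeo pillowK pillow_invK
  (descent_continuous stretch1B stretch1_lattice stretch1_lipschitz)
  (descent_continuous stretch2B stretch2_lattice stretch2_lipschitz).

Lemma leaf_sub_Cs c p q : p.1 = q.1 -> `|p - q| <= c ->
  Cs pillow_map c (ppi p) (ppi q).
Proof.
move=> pq; apply: (leaf_sub_component (l := fst) stretch1B _ stretch1_lattice
  stretch1_expands stretch1_contracts) => //.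
by rewrite /= pq subrr.
Qed.

Lemma leaf_sub_Cu c p q : p.2 = q.2 -> `|p - q| <= c ->
  Cu pillow_map c (ppi p) (ppi q).
Proof.
move=> pq; apply: (leaf_sub_component (l := snd) stretch2B _ stretch2_lattice
  stretch2_expands stretch2_contracts) => //.
by rewrite /= pq subrr.
Qed.

Lemma Cs_sub_leaf c p z : 0 < c -> 28 * c <= 1 -> Cs pillow_map c (ppi p) z ->
  exists q, [/\ ppi q = z, `|p - q| < 1 / 2 & p.1 = q.1].
Proof.
move=> c0 c1 /(component_sub_leaf (l := fst) stretch1B
  stretch1_lattice stretch1_lipschitz fst_norm stretch1_expands c0 c1)[q [qz pq lq]].
by exists q; split=> //; apply/eqP; rewrite -subr_eq0; apply/eqP.
Qed.

Lemma Cu_sub_leaf c p z : 0 < c -> 28 * c <= 1 -> Cu pillow_map c (ppi p) z ->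
  exists q, [/\ ppi q = z, `|p - q| < 1 / 2 & p.2 = q.2].
Proof.
move=> c0 c1 /(component_sub_leaf (l := snd) stretch2B
  stretch2_lattice stretch2_lipschitz snd_norm stretch2_expands c0 c1)[q [qz pq lq]].
by exists q; split=> //; apply/eqP; rewrite -subr_eq0; apply/eqP.
Qed.

(** For nearby lifts [p] and [q], the vertical line through [p] meets the
horizontal line through [q] at [(p.1, q.2)]. *)
Lemma pillow_lps : cw_local_product_structure pillow_map.
Proof.
move=> e e0; exists e => // x y; rewrite -(pliftK x) => /mdist_lift[q <- pq].
set p := plift x in pq *; exists (ppi (p.1, q.2)).
move: pq; rewrite norm2_lt /= => /andP[pq1 pq2].
split; [apply: leaf_sub_Cs | apply: leaf_sub_Cu] => //; rewrite norm2_le /=.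
  by rewrite subrr normr0 !ltW.
by rewrite subrr normr0 distrC !ltW.
Qed.

(** A common point other than [ppi p] has a vertical lift [(p.1, r.2)] and a
horizontal lift [(r.1, p.2)] exchanged by a half turn, whose translation part is
the sum [p + r] of the two lifts. By discreteness this determines [r]. *)
Lemma leaves_meet c p z : 0 < c -> 28 * c <= 1 ->
  (Cs pillow_map c (ppi p) `&` Cu pillow_map c (ppi p)) z -> z <> ppi p ->
  exists r : R * R, [/\ lattice (p + r), `|p - r| < 1 / 2 & z = ppi (p.1, r.2)].
Proof.
move=> c0 c1 [/(Cs_sub_leaf c0 c1)[q [qz pq pq1]]].
move=> /(Cu_sub_leaf c0 c1)[q' [qz' pq' pq2]] zp.
have /ppiP[v lv [q'E|q'E]] : ppi q = ppi q' by rewrite qz.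
  have v0 : v = 0.
    apply: lattice_discrete lv _; have -> : v = q' - q by rewrite q'E addrK.
    rewrite (le_lt_trans (ler_distD p _ _))// distrC; lra.
  case: zp; rewrite -qz; congr ppi; move: pq2; rewrite q'E v0 add0r => pq2.
  by rewrite (surjective_pairing p) pq1 pq2 -surjective_pairing.
exists (q'.1, q.2); split; last by rewrite -qz pq1 -surjective_pairing.
  suff -> : p + (q'.1, q.2) = v by [].
  have -> : v = q' + q by rewrite q'E subrK.
  rewrite (surjective_pairing q') (surjective_pairing q) (surjective_pairing p).
  by rewrite pq1 pq2; congr pair; rewrite /= addrC.
move: pq pq'; rewrite !norm2_lt /= => /andP[_ ->] /andP[-> _] //.
Qed.

Lemma pillow_meet_le2 c x : 0 < c -> 28 * c <= 1 ->
  Cs pillow_map c x `&` Cu pillow_map c x #<= `I_2.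
Proof.
move=> c0 c1; rewrite -(pliftK x); set p := plift x.
(* being different from the centre is an injective map to {0, 1} *)
apply/card_le_II_inj; exists (fun z => nat_of_bool (z != ppi p)) => [z _|z z'].
  by rewrite /=; case: (z != _).
rewrite !inE => zI z'I; case: (eqVneq z (ppi p)) => [->|/eqP zp];
  case: (eqVneq z' (ppi p)) => [->|/eqP z'p] //= _.
have [r [lr pr ->]] := leaves_meet c0 c1 zI zp.
have [r' [lr' pr' ->]] := leaves_meet c0 c1 z'I z'p.
have := latticeB lr lr'; rewrite opprD addrACA subrr add0r => /lattice_discrete rr'.
suff -> : r = r' by [].
apply/eqP; rewrite -subr_eq0; apply/eqP/rr'.
by rewrite (le_lt_trans (ler_distD p _ _))// distrC; lra.
Qed.

(** Near the cone point [ppi 0], the vertical leaf of [(t, t)] contains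
[(t, - t)] and its horizontal leaf contains [(- t, t)], which is the same point
of the quotient. *)
Lemma pillow_meet_ge2 c : 0 < c -> exists x (g : nat -> pillow R),
  set_fun `I_2 (Cs pillow_map c x `&` Cu pillow_map c x) g /\ set_inj `I_2 g.
Proof.
move=> c0; pose t := Num.min c (1 / 2) / 2.
have t0 : 0 < t by rewrite divr_gt0// lt_min c0 divr_gt0.
have tc : t + t <= c by rewrite -splitr ge_min lexx.
have t1 : t + t < 1 by rewrite -splitr gt_min [X in _ || X](_ : _ = true) ?orbT//; lra.
have norm2t : `|t + t| = t + t by rewrite ger0_norm// addr_ge0// ltW.
have ne : ppi (t, t) <> ppi (t, - t).
  move=> /ppiP[v lv [/(congr1 (fun q => q - (t, t)))|/(congr1 (fun q => q + (t, t)))]].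
    rewrite addrK => vE; have v0 : v = 0.
      apply: lattice_discrete lv _; rewrite -vE norm2_lt /= subrr normr0 ltr01.
      by rewrite -opprD normrN norm2t.
    by move: vE; rewrite v0 => /(congr1 snd) /=; lra.
  rewrite subrK => vE; have v0 : v = 0.
    apply: lattice_discrete lv _; rewrite -vE norm2_lt /= norm2t t1.
    by rewrite addrC subrr normr0 ltr01.
  by move: vE; rewrite v0 => /(congr1 fst) /=; lra.
exists (ppi (t, t)), (fun i => if i == 0%N then ppi (t, t) else ppi (t, - t)); split.
- have tt : (Cs pillow_map c (ppi (t, t)) `&` Cu pillow_map c (ppi (t, t))) (ppi (t, t)).
    by split; [apply: leaf_sub_Cs | apply: leaf_sub_Cu] => //; rewrite subrr normr0 ltW.
  case=> [|[|//]] _ /=; [exact: tt|split].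
    by apply: leaf_sub_Cs => //; rewrite norm2_le /= subrr normr0 (ltW c0) opprK norm2t.
  rewrite -(ppiN (t, - t)); apply: leaf_sub_Cu; first by rewrite /= opprK.
  by rewrite opprK norm2_le /= subrr normr0 (ltW c0) norm2t tc.
- by move=> i j; rewrite !inE; case: i j => [|[|i]] [|[|j]] //= _ _ tE; case: ne.
Qed.

Lemma pillow_sharp : cw_sharp pillow_map 2.
Proof.
split; [exact: pillow_peano | exact: pillow_lps | | exact: pillow_meet_ge2].
by exists (1 / 28) => [|x]; [lra | apply: pillow_meet_le2; lra].
Qed.

End PillowMap.

Lemma cw_sharp_pow (R : realType) (N : nat) :
  exists (X : metricType R) (f : homeo X), cw_sharp f (2 ^ N.+1)%N.
Proof.
elim: N => [|N [X [f fN]]].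
  by exists (pillow R), (pillow_map R); exact: pillow_sharp.
exists (X * pillow R)%type, (homeo_prod f (pillow_map R)).
by rewrite expnSr; exact: cw_sharp_prod fN (pillow_sharp R).
Qed.

Local Open Scope classical_set_scope.

Theorem corollary3p3 (R : realType) (N : nat) (HN : (0 < N)%N) :
  exists (X : metricType R) (f : homeo X),
    [/\ compact [set: X],
        cwM_hyperbolic f (2 ^ N)%N &
        ~ cwM_expansive f (2 ^ N - 1)%N].
Proof.
case: N HN => // N _; have [X [f fN]] := cw_sharp_pow R N.
by exists X, f; apply: cw_sharp_hyperbolic fN; rewrite expn_gt0.
Qed.
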